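(* Let $x_L < x_R$, let $\mathcal{F} \subset C^2([x_L,x_R])$ be a linear function space, let $x_L = x_1 < x_2 < \dots < x_N = x_R$ be grid points, and let $B = \operatorname{diag}(-1,0,\dots,0,1) \in \mathbb{R}^{N \times N}$. Let $D_1 = P^{-1} Q$ be a first-derivative FSBP operator on these grid points with $Q + Q^T = B$ (no function space on which $D_1$ is exact is specified in this hypothesis). Then the operator $$D_2 = P^{-1}\left( B D_1 - D_1^T P D_1 \right)$$ approximating $\partial_{xx}$ is an $\mathcal{F}$-exact second-derivative FSBP operator if and only if $D_1$ is $(\mathcal{F} \bigoplus \mathcal{F}')$-exact.
   Context: For a function $f$ on $[x_L,x_R]$ and grid points $x_1,\dots,x_N$, write $\mathbf{f} = [f(x_1),\dots,f(x_N)]^T$, $\mathbf{f'} = [f'(x_1),\dots,f'(x_N)]^T$ and $\mathbf{f''} = [f''(x_1),\dots,f''(x_N)]^T$ for the vectors of nodal values of $f$ and its first two derivatives (whenever these exist). $\mathcal{F}' = \{ f' \mid f \in \mathcal{F} \}$, and $\mathcal{F} \bigoplus \mathcal{F}' = \{ f_1 + f_2 \mid f_1 \in \mathcal{F}, f_2 \in \mathcal{F}' \}$ is the smallest linear function space containing both $\mathcal{F}$ and $\mathcal{F}'$ (their intersection need not be trivial, despite the notation). First-derivative FSBP (function-space summation-by-parts) operators: for a function space $\mathcal{G} \subset C^1([x_L,x_R])$, an operator (matrix) $D_1 = P^{-1} Q \in \mathbb{R}^{N \times N}$ approximating $\partial_x$ is a $\mathcal{G}$-exact first-derivative FSBP operator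 if (i) $D_1 \mathbf{g} = \mathbf{g'}$ for all $g \in \mathcal{G}$; (ii) $P$ is a symmetric positive definite matrix; (iii) $Q + Q^T = B = \operatorname{diag}(-1,0,\dots,0,1)$. Saying that $D_1$ is $\mathcal{G}$-exact refers to condition (i). When $D_1$ is called a first-derivative FSBP operator without naming a space, it is an operator $P^{-1}Q$ approximating $\partial_x$ with the structure (ii) and (iii), and exactness on $\mathcal{F}$ or any other particular space is not presupposed. Second-derivative FSBP operators: for $\mathcal{F} \subset C^2([x_L,x_R])$, let $D_2 = P^{-1}( B S - D_1^T P D_1 )$ be an approximation of $\partial_{xx}$, where $D_1$ is a consistent approximation of $\partial_x$, $S$ satisfies $B S = B D_1$, and $B = \operatorname{diag}(-1,0,\dots,0,1)$. The operator $D_2$ is an $\mathcal{F}$-exact second-derivative FSBP operator if (i) $D_2 \mathbf{f} = \mathbf{f''}$ for all $f \in \mathcal{F}$; and (ii) $P$ is a symmetric positive definite matrix. In the claim, $B S$ has been replaced by $B D_1$.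
   Formalization: The ''consistent approximation'' required of D_1 in the definition of a second-derivative FSBP operator is read as exactness of D_1 on F; with only exactness on linear polynomials, ''only if'' fails (N=2, nodes 0,1, P=I/2, D_1=[[-1,1],[-1,1]], F=span{sin(pi x)}). *)

(* Defs.v *)
From mathcomp Require Import all_boot all_order all_algebra.
From mathcomp Require Import all_classical all_reals all_analysis.
Import Order.TTheory GRing.Theory Num.Theory.
Import numFieldNormedType.Exports.

Set Implicit Arguments.
Unset Strict Implicit.
Unset Printing Implicit Defensive.

Local Open Scope classical_set_scope.
Local Open Scope ring_scope.

(* Functions on the closed interval [a, b] are represented by total functions
   R -> R; nothing below depends on their values outside [a, b]. *)

Definition diff_quot {R : realType} (f : R -> R) (x : R) : R -> R :=
  fun y => (f y - f x) / (y - x).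

(* Punctured neighbourhoods of x relative to [a, b]: the resulting derivatives
   are one-sided at the endpoints. *)
Definition nbhs_itv {R : realType} (a b x : R) : set_system R :=
  within `[a, b]%classic x^'.

Definition derivable_on {R : realType} (a b : R) (f : R -> R) : Prop :=
  forall x, x \in `[a, b] -> cvg (diff_quot f x @ nbhs_itv a b x).

(* The value is meaningful only for x in [a, b]. *)
Definition deriv_on {R : realType} (a b : R) (f : R -> R) : R -> R :=
  fun x => lim (diff_quot f x @ nbhs_itv a b x).

Definition C1_on {R : realType} (a b : R) : set (R -> R) :=
  [set f | derivable_on a b f /\ {within `[a, b], continuous (deriv_on a b f)}].

Definition C2_on {R : realType} (a b : R) : set (R -> R) :=
  [set f | C1_on a b f /\ C1_on a b (deriv_on a b f)].

Definition linear_space {R : realType} (F : set (R -> R)) : Prop :=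
  F (fun=> 0) /\
  forall (c : R) (f g : R -> R), F f -> F g -> F (fun x => c * f x + g x).

Definition deriv_space {R : realType} (a b : R) (F : set (R -> R)) :
  set (R -> R) := [set deriv_on a b f | f in F].

Definition sum_space {R : realType} (F G : set (R -> R)) : set (R -> R) :=
  [set (fun x => f x + g x) | f in F & g in G].

Section FSBP.
Context {R : realType} (a b : R) {n : nat}.
Implicit Types (x : 'I_n.+1 -> R) (F G : set (R -> R)).
Implicit Types (P Q D S : 'M[R]_n.+1).

(* a < b excludes the one-point case n = 0. *)
Definition grid x : Prop :=
  [/\ x ord0 = a, x ord_max = b &
      forall i j : 'I_n.+1, (i < j)%N -> x i < x j].

Definition nodal x (f : R -> R) : 'cV[R]_n.+1 := \col_i f (x i).

Definition bdry_mx : 'M[R]_n.+1 :=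
  diag_mx (\row_i ((i == ord_max)%:R - (i == ord0)%:R)).

Definition spd_mx P : Prop :=
  P^T = P /\ forall v : 'cV[R]_n.+1, v != 0 -> 0 < (v^T *m P *m v) ord0 ord0.

Definition exact1 x G D : Prop :=
  forall g, G g -> D *m nodal x g = nodal x (deriv_on a b g).

Definition exact2 x F D : Prop :=
  forall f, F f -> D *m nodal x f = nodal x (deriv_on a b (deriv_on a b f)).

(* D = P^-1 Q, with no function space on which it has to be exact. *)
Definition FSBP1_op P Q D : Prop :=
  [/\ D = invmx P *m Q, spd_mx P & Q + Q^T = bdry_mx].

(* The definition of an F-exact second-derivative operator asks for the D1
   it is built from to be a consistent approximation of the first derivative.
   Consistency is relative to the function space: D1 differentiates the
   elements of F exactly at the nodes, as consistency of polynomial SBP operators is exactness on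
   polynomials. *)
Definition consistent x F D : Prop := exact1 x F D.

(* An operator is given together with the P and D1 it is built from. *)
Definition FSBP2_op x F P (D1 D2 : 'M[R]_n.+1) : Prop :=
  [/\ consistent x F D1,
      exists2 S, bdry_mx *m S = bdry_mx *m D1 &
        D2 = invmx P *m (bdry_mx *m S - D1^T *m P *m D1),
      exact2 x F D2 & spd_mx P].

End FSBP.

(* Main.v *)
Require Import Defs.
From mathcomp Require Import all_boot all_order all_algebra.
From mathcomp Require Import all_classical all_reals all_analysis.
From mathcomp Require Import lra.
Import Order.TTheory GRing.Theory Num.Theory.
Import numFieldNormedType.Exports.

Local Open Scope classical_set_scope.
Local Open Scope ring_scope.

(** The whole equivalence rests on the identity [D2 = D1 *m D1]: since
    [D1 = P^-1 Q] with [P] symmetric, [D1^T P D1 = Q^T D1], so that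
    [B D1 - D1^T P D1 = (B - Q^T) D1 = Q D1] by the summation-by-parts property
    [Q + Q^T = B] (lemma [FSBP1_op_sqr]).

    Write [E(g) = D1 g - g'] for the vector of nodal errors, so that exactness
    is the vanishing of [E]. If [D1] is exact on [F], then for [f] in [F] one
    has [D2 f = D1 (D1 f) = D1 f'], and [D2 f = f''] says precisely that
    [E(f') = 0]. Hence the second-derivative property amounts to exactness of
    [D1] on [F] and on [F'] separately (lemma [exact2_sqr]).

    Differentiation on the interval is additive, so [E(f + g') = E(f) + E(g')],
    and exactness on [F] and [F'] gives exactness on the sum. Conversely the sum
    contains [0 + g'] and [f + 0'] for the zero function [0] of [F], which
    separates the two summands (lemma [exact1_sum_space]). *)

(** If [a = b] the interval is one point, whose punctured neighbourhood relative to
    the interval is empty, and limits along it are meaningless. Otherwise a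
    point can be approached from at least one side, at the endpoints too. *)
Lemma nbhs_itv_proper (R : realType) (a b x : R) :
  a < b -> x \in `[a, b] -> ProperFilter (nbhs_itv a b x).
Proof.
move=> ab; rewrite in_itv /= => /andP[ax xb].
split; last exact: within_filter.
rewrite /nbhs_itv /within /dnbhs /= => /nbhs_ballP[e /= e0 He].
suff [y [yx ay yb]] : exists y, [/\ y != x, a <= y <= b & `|x - y| < e].
  by apply: (He y yb yx); rewrite /= in_itv.
have [xltb|blex] := ltP x b.
- exists (Num.min (x + e / 2) b).
  have [h|h] := leP (x + e / 2) b.
  + by split; [apply/eqP => yx; lra|lra|rewrite ltr_norml; lra].
  + by split; [apply/eqP => yx; lra|lra|rewrite ltr_norml; lra].
- exists (Num.max (x - e / 2) a).
  have [h|h] := leP (x - e / 2) a.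
  + by split; [apply/eqP => yx; lra|lra|rewrite ltr_norml; lra].
  + by split; [apply/eqP => yx; lra|lra|rewrite ltr_norml; lra].
Qed.

Lemma deriv_on0 (R : realType) (a b x : R) :
  a < b -> x \in `[a, b] -> deriv_on a b (fun=> 0) x = 0.
Proof.
move=> ab xab; have FF := nbhs_itv_proper _ _ _ _ ab xab.
rewrite /deriv_on; apply: cvg_lim => //.
have -> : diff_quot (fun=> 0 : R) x = cst 0.
  by apply/funext => y; rewrite /diff_quot subrr mul0r.
exact: cvg_cst.
Qed.

Lemma deriv_onD (R : realType) (a b : R) (f g : R -> R) (x : R) :
  a < b -> x \in `[a, b] -> derivable_on a b f -> derivable_on a b g ->
  deriv_on a b (fun y => f y + g y) x = deriv_on a b f x + deriv_on a b g x.
Proof.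
move=> ab xab df dg; have FF := nbhs_itv_proper _ _ _ _ ab xab.
rewrite /deriv_on; apply: cvg_lim => //.
have -> : diff_quot (fun y => f y + g y) x = diff_quot f x \+ diff_quot g x.
  by apply/funext => y; rewrite /diff_quot /= -mulrDl opprD addrACA.
by apply: cvgD; [exact: df|exact: dg].
Qed.

Lemma grid_itv (R : realType) (a b : R) (n : nat) (x : 'I_n.+1 -> R)
    (i : 'I_n.+1) : grid a b x -> x i \in `[a, b].
Proof.
move=> [x0 xn xlt]; rewrite in_itv /=; apply/andP; split.
- have [->|i0] := eqVneq i ord0; first by rewrite x0.
  by rewrite -x0 ltW// xlt// lt0n.
- have [->|im] := eqVneq i ord_max; first by rewrite xn.
  rewrite -xn ltW// xlt//= ltn_neqAle -ltnS ltn_ord andbT.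
  by apply: contraNneq im => im; apply/eqP/val_inj.
Qed.

Lemma nodalD (R : realType) (n : nat) (x : 'I_n.+1 -> R) (f g : R -> R) :
  nodal x (fun y => f y + g y) = nodal x f + nodal x g.
Proof. by apply/colP => i; rewrite !mxE. Qed.

Lemma nodal_deriv_onD (R : realType) (a b : R) (n : nat) (x : 'I_n.+1 -> R)
    (f g : R -> R) :
  a < b -> grid a b x -> derivable_on a b f -> derivable_on a b g ->
  nodal x (deriv_on a b (fun y => f y + g y)) =
  nodal x (deriv_on a b f) + nodal x (deriv_on a b g).
Proof.
move=> ab hx df dg; apply/colP => i; rewrite !mxE.
by apply: deriv_onD => //; exact: grid_itv.
Qed.

(** A kernel vector [v] of [P] would satisfy [v^T P v = 0]. *)
Lemma spd_unitmx (R : realType) (n : nat) (P : 'M[R]_n.+1) :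
  spd_mx P -> P \in unitmx.
Proof.
move=> [PT Ppos]; rewrite -row_free_unit -kermx_eq0.
apply/negPn/negP => /rowV0Pn[v /sub_kermxP vP v0].
have := Ppos v^T; rewrite trmxK vP mul0mx mxE ltxx; apply/implyP.
by rewrite -trmx0 (inj_eq trmx_inj) v0.
Qed.

(** Symmetry of [P] gives [D^T P = Q^T], and [bdry_mx - Q^T = Q] is summation by
    parts: the boundary term cancels against the adjoint part of [D^T P D]. *)
Lemma FSBP1_op_sqr (R : realType) (n : nat) (P Q D : 'M[R]_n.+1) :
  FSBP1_op P Q D ->
  invmx P *m (bdry_mx *m D - D^T *m P *m D) = D *m D.
Proof.
move=> [DE Pspd QB]; have PU := spd_unitmx _ _ _ Pspd.
have -> : D^T *m P = Q^T.
  by rewrite DE trmx_mul trmx_inv (proj1 Pspd) mulmxKV.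
by rewrite -QB -mulmxBl addrK mulmxA -DE.
Qed.

(** Exactness on [F] turns the inner factor of [D *m D] into differentiation;
    what remains is exactness of the outer factor on the derivatives. *)
Lemma exact2_sqr (R : realType) (a b : R) (n : nat) (x : 'I_n.+1 -> R)
    (F : set (R -> R)) (D : 'M[R]_n.+1) :
  exact1 a b x F D ->
  exact2 a b x F (D *m D) <-> exact1 a b x (deriv_space a b F) D.
Proof.
move=> DF; split=> [D2F _ [f Ff <-]|DF' f Ff].
- by rewrite -DF// mulmxA D2F.
- by rewrite -mulmxA DF// DF'//; exists f.
Qed.

(** The nodal error is additive on the sum. Taking the first summand to be the
    zero function, whose error vanishes because its derivative is zero on the
    interval, isolates the error on [F']; exactness on [F'] then isolates the
    error on [F]. *)
Lemma exact1_sum_space (R : realType) (a b : R) (n : nat) (x : 'I_n.+1 -> R)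
    (F : set (R -> R)) (D : 'M[R]_n.+1) :
  a < b -> grid a b x -> F (fun=> 0) -> F `<=` C2_on a b ->
  exact1 a b x (sum_space F (deriv_space a b F)) D <->
  exact1 a b x F D /\ exact1 a b x (deriv_space a b F) D.
Proof.
move=> ab hx F0 FC2.
have dF f : F f -> derivable_on a b f by move=> /FC2[[]].
have dF' g : deriv_space a b F g -> derivable_on a b g.
  by move=> [f /FC2[_ []]] df _ <-.
have errD f g : F f -> deriv_space a b F g ->
    D *m nodal x (fun y => f y + g y) =
      nodal x (deriv_on a b (fun y => f y + g y)) <->
    D *m nodal x f + D *m nodal x g =
      nodal x (deriv_on a b f) + nodal x (deriv_on a b g).
  move=> Ff Gg; rewrite nodalD mulmxDr nodal_deriv_onD//; [exact: dF|exact: dF'].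
split=> [DS|[DF DF'] _ [f Ff [g Gg <-]]]; last first.
  by apply/errD => //; rewrite DF// DF'.
have DSD f g : F f -> deriv_space a b F g -> D *m nodal x f + D *m nodal x g =
    nodal x (deriv_on a b f) + nodal x (deriv_on a b g).
  by move=> Ff Gg; apply/errD => //; apply: DS; exists f => //; exists g.
have DF' : exact1 a b x (deriv_space a b F) D.
  move=> g Gg; have := DSD _ _ F0 Gg.
  have -> : nodal x (fun=> 0) = 0 by apply/colP => i; rewrite !mxE.
  have -> : nodal x (deriv_on a b (fun=> 0)) = 0.
    by apply/colP => i; rewrite !mxE deriv_on0//; exact: grid_itv.
  by rewrite mulmx0 !add0r.
split=> // f Ff.
have G0 : deriv_space a b F (deriv_on a b (fun=> 0)) by exists (fun=> 0).
by have := DSD _ _ Ff G0; rewrite (DF' _ G0) => /addIr.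
Qed.

Theorem theorem3p1 (R : realType) (xL xR : R) (n : nat) (x : 'I_n.+1 -> R)
    (F : set (R -> R)) (P Q D1 D2 : 'M[R]_n.+1)
    (xLR : xL < xR) (hx : grid xL xR x)
    (Flin : linear_space F) (FC2 : F `<=` C2_on xL xR)
    (hD1 : FSBP1_op P Q D1)
    (hD2 : D2 = invmx P *m (bdry_mx *m D1 - D1^T *m P *m D1)) :
  FSBP2_op xL xR x F P D1 D2 <->
  exact1 xL xR x (sum_space F (deriv_space xL xR F)) D1.
Proof.
have D2E : D2 = D1 *m D1 by rewrite hD2; exact: FSBP1_op_sqr hD1.
rewrite exact1_sum_space//; last by case: Flin.
split=> [[DF _ D2F _]|[DF DF']].
- by split=> //; apply/exact2_sqr => //; rewrite -D2E.
- split=> //; last by case: hD1.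
  + by exists D1.
  + by rewrite D2E; apply/exact2_sqr.
Qed.
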